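(* For every finite connected weighted graph $G=(V,E,w)$ with $|V|=n\ge2$ and $w:E\to\mathbb{R}_{>0}$, $$1\le\frac{\operatorname{OPT}_{\mathrm{card}}(G,w)}{\operatorname{OPT}_{\mathrm{free}}(G,w)}\le\frac{2n-1}{3}.$$ The upper factor is best possible for every $n\ge2$: equality $\operatorname{OPT}_{\mathrm{card}}/\operatorname{OPT}_{\mathrm{free}}=(2n-1)/3$ holds for the unweighted complete graph $K_n$ (all edge weights equal to $1$).
   Context: $d_G$ is the shortest-path metric of the support graph $(V,E)$ with every edge of length $1$; the weights are not edge lengths. An ultrametric on $V$ is a metric $u$ with $u(x,y)\le\max\{u(x,z),u(z,y)\}$ for all $x,y,z$. $\operatorname{OPT}_{\mathrm{free}}(G,w)$ is the minimum of $\sum_{xy\in E}w_{xy}u(x,y)$ over all ultrametrics $u$ on $V$ with $u(x,y)\ge d_G(x,y)$ for all $x,y\in V$ (the minimum is attained). A rooted binary hierarchy $H$ on $V$ is a rooted tree whose leaves are the vertices of $V$ and whose internal nodes have exactly two children; each node is identified with the set of leaves below it (a cluster), and $C_H(x,y)$ is the cluster of the lowest common ancestor of $x,y$. Put $h_H(x,x)=0$ and $h_H(x,y)=|C_H(x,y)|-1$ for $x\ne y$. $\operatorname{OPT}_{\mathrm{card}}(G,w)$ is the minimum of $\sum_{xy\in E}w_{xy}h_H(x,y)$ over all rooted binary hierarchies $H$ on $V$ with $h_H(x,y)\ge d_G(x,y)$ for all $x,y\in V$. *)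

(* Defs.v *)
From mathcomp Require Import all_boot all_order all_algebra.
From mathcomp Require Import boolp classical_sets reals.
Set Implicit Arguments.
Unset Strict Implicit.
Unset Printing Implicit Defensive.
Import Order.TTheory GRing.Theory Num.Theory.
Local Open Scope ring_scope.

(* A weighted graph on the finite type V is given by its adjacency relation
   e : rel V and a function w : V -> V -> R; the value w x y is only meaningful
   when e x y holds. *)

(* The number of edges of a shortest walk from x to y. A shortest walk repeats
   no vertex, so lengths k < #|V| suffice; the value is #|V| if there is no walk
   at all. *)
Definition gdist (V : finType) (e : rel V) (x y : V) : nat :=
  find (fun k : nat => [exists p : k.-tuple V, path e x p && (last x p == y)])
       (iota 0 #|V|).

(* Each edge {x, y} occurs twice in the double sum, as (x, y) and as (y, x). *)
Definition wcost (R : realType) (V : finType) (e : rel V) (w : V -> V -> R)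
    (u : V -> V -> R) : R :=
  (\sum_x \sum_(y | e x y) w x y * u x y) / 2.

Definition metric (R : realType) (V : finType) (u : V -> V -> R) : Prop :=
  [/\ forall x y, 0 <= u x y,
      forall x y, u x y = 0 <-> x = y,
      forall x y, u x y = u y x
    & forall x y z, u x y <= u x z + u z y].

Definition ultrametric (R : realType) (V : finType) (u : V -> V -> R) : Prop :=
  metric u /\ forall x y z, u x y <= Num.max (u x z) (u z y).

Definition dominates (R : realType) (V : finType) (e : rel V)
    (u : V -> V -> R) : Prop :=
  forall x y, (gdist e x y)%:R <= u x y.

Definition free_costs (R : realType) (V : finType) (e : rel V)
    (w : V -> V -> R) : set R :=
  [set c | exists u, [/\ ultrametric u, dominates e u & c = wcost e w u]]%classic.

(* The infimum is a minimum for positive edge weights: see OPT_free_min. *)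
Definition OPT_free (R : realType) (V : finType) (e : rel V)
    (w : V -> V -> R) : R := inf (free_costs e w).

(* The left/right order of the two children carries no information: nothing
   below depends on it. *)
Inductive btree (V : Type) : Type :=
| Leaf of V
| Node of btree V & btree V.

Fixpoint leaves (V : Type) (t : btree V) : seq V :=
  match t with
  | Leaf x => [:: x]
  | Node l r => leaves l ++ leaves r
  end.

Definition hierarchy (V : finType) (H : btree V) : Prop :=
  perm_eq (leaves H) (enum V).

Definition cluster (V : finType) (t : btree V) : {set V} :=
  [set x in leaves t]%SET.

(* C_H(x, y), for leaves x and y of H: descend from the root as long as x and y
   lie below the same child. *)
Fixpoint lca_cluster (V : finType) (H : btree V) (x y : V) : {set V} :=
  match H with
  | Leaf _ => cluster H
  | Node l r =>
      if (x \in cluster l) && (y \in cluster l) then lca_cluster l x y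
      else if (x \in cluster r) && (y \in cluster r) then lca_cluster r x y
      else cluster H
  end.

Definition hcard (V : finType) (H : btree V) (x y : V) : nat :=
  if x == y then 0%N else #|lca_cluster H x y|.-1.

Definition hcardR (R : realType) (V : finType) (H : btree V) (x y : V) : R :=
  (hcard H x y)%:R.

Definition card_costs (R : realType) (V : finType) (e : rel V)
    (w : V -> V -> R) : set R :=
  [set c | exists H : btree V,
    [/\ hierarchy H, dominates e (hcardR R H)
      & c = wcost e w (hcardR R H)]]%classic.

(* The infimum is a minimum whenever some hierarchy is feasible: see
   OPT_card_min. *)
Definition OPT_card (R : realType) (V : finType) (e : rel V)
    (w : V -> V -> R) : R := inf (card_costs e w).

Definition complete (V : finType) : rel V := fun x y => x != y.

Lemma inf_attained (R : realType) (I : finType) (c : I -> R) (S : set R) :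
  (forall s, S s -> exists2 i, S (c i) & c i <= s) ->
  (exists s, S s) -> S (inf S).
Proof.
move=> dom [s0 Ss0]; have [i0 Si0 _] := dom _ Ss0.
have Pi0 : `[< S (c i0) >] by apply/asboolP.
case: (@arg_minP _ _ _ i0 (fun i => `[< S (c i) >]) c Pi0) => i /asboolP Si mini.
have lbi s : S s -> c i <= s.
  by move=> /dom[j Sj]; apply: le_trans; apply: mini; apply/asboolP.
suff -> : inf S = c i by [].
apply/eqP; rewrite eq_le; apply/andP; split.
  by apply: ge_inf => //; exists (c i) => s /lbi.
by apply: lb_le_inf; [exists (c i) | move=> s /lbi].
Qed.

Lemma gdist_le_card (V : finType) (e : rel V) x y : (gdist e x y <= #|V|)%N.
Proof. by rewrite -[X in (_ <= X)%N](size_iota 0); apply: find_size. Qed.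

Lemma gdist_eq0 (V : finType) (e : rel V) x y : (gdist e x y == 0%N) = (x == y).
Proof.
have : (0 < #|V|)%N by apply/card_gt0P; exists x.
rewrite /gdist; case: #|V| => // m _ /=.
have -> : [exists p : 0.-tuple V, path e x p && (last x p == y)] = (x == y).
  apply/existsP/idP => [[p]|xy]; first by rewrite tuple0.
  by exists [tuple].
by case: (x == y).
Qed.

Section Minima.
Variables (R : realType) (V : finType) (e : rel V) (w : V -> V -> R).

Let natfun (f : {ffun V * V -> 'I_#|V|.+1}) (x y : V) : R := (f (x, y) : nat)%:R.

(* Replacing u x y by the gdist-diameter of the closed u-ball of radius u x y
   around x yields an integer-valued feasible ultrametric below u. *)
Let diam (u : V -> V -> R) (x y : V) : nat :=
  \max_(a | (u x a <= u x y)%R) \max_(b | (u x b <= u x y)%R) gdist e a b.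

Let diamP u x y a b :
  u x a <= u x y -> u x b <= u x y -> (gdist e a b <= diam u x y)%N.
Proof.
move=> ha hb; apply: leq_trans (leq_bigmax_cond _ ha).
exact: leq_bigmax_cond hb.
Qed.

Let diam_le u x y m :
  (forall a b, u x a <= u x y -> u x b <= u x y -> (gdist e a b <= m)%N) ->
  (diam u x y <= m)%N.
Proof. by move=> h; apply/bigmax_leqP => a ha; apply/bigmax_leqP => b; apply: h. Qed.

Let diam_feasible u : ultrametric u -> dominates e u ->
  let v := fun x y => (diam u x y)%:R : R in
  [/\ ultrametric v, dominates e v & forall x y, v x y <= u x y].
Proof.
move=> [[u0 us uC _] uU] ude v.
have ub x y z r : u x y <= r -> u y z <= r -> u x z <= r.
  by move=> hx hz; apply: le_trans (uU x z y) _; rewrite ge_max hx hz.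
have uxx x : u x x = 0 by apply/us.
have dv : dominates e v.
  by move=> x y; rewrite ler_nat; apply: diamP => //; rewrite uxx u0.
have vu x y : v x y <= u x y.
  have : forall a b, u x a <= u x y -> u x b <= u x y ->
      ((gdist e a b)%:R : R) <= u x y.
    by move=> a b ha hb; apply: le_trans (ude a b) _; apply: (ub a x) => //; rewrite uC.
  move=> h; rewrite /v /diam.
  have big_le (P : pred V) (F : V -> nat) :
      (forall a, P a -> (F a)%:R <= u x y) -> (\max_(a | P a) F a)%:R <= u x y.
    move=> hF; elim/big_rec: _ => [|i m Pi hm]; first exact: u0.
    by rewrite /maxn; case: ifP => // _; apply: hF.
  by apply: (big_le _ _) => a ha; apply: (big_le _ _) => b hb; apply: h.
have vC x y : diam u x y = diam u y x.
  apply/eqP; rewrite eqn_leq; apply/andP; split; apply: diam_le => a b ha hb.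
    by apply: diamP; apply: (ub y x) => //; rewrite (uC y x).
  by apply: diamP; apply: (ub x y) => //; rewrite (uC x y).
have mon x y z : u x y <= u x z -> (diam u x y <= diam u x z)%N.
  by move=> h; apply: diam_le => a b ha hb; apply: diamP; apply: le_trans h.
have vU x y z : (diam u x y <= maxn (diam u x z) (diam u z y))%N.
  have := uU x y z; rewrite le_max leq_max => /orP[] h.
    by rewrite mon.
  by rewrite [diam u x y]vC [diam u z y]vC mon ?orbT // (uC y x) (uC y z).
have vUR x y z : v x y <= Num.max (v x z) (v z y).
  by have := vU x y z; rewrite leq_max le_max !ler_nat.
split=> //; split=> //; split.
- by move=> x y; apply: ler0n.
- move=> x y; split=> [/eqP|->]; last first.
    by apply/eqP; rewrite eq_le ler0n andbT -(uxx y) vu.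
  rewrite pnatr_eq0 => /eqP v0; apply/eqP; rewrite -(gdist_eq0 e) -leqn0 -v0.
  by apply: diamP; rewrite ?uxx.
- by move=> x y; rewrite /v vC.
- move=> x y z; apply: le_trans (vUR x y z) _.
  by rewrite ge_max lerDl lerDr !ler0n.
Qed.

Lemma wcost_le u v : (forall x y, e x y -> 0 < w x y) ->
  (forall x y, v x y <= u x y) -> wcost e w v <= wcost e w u.
Proof.
move=> w0 vu; rewrite ler_wpM2r ?invr_ge0 ?ler0n //.
by apply: ler_sum => x _; apply: ler_sum => y /w0/ltW h; apply: ler_wpM2l.
Qed.

Lemma OPT_free_min : (forall x y, e x y -> 0 < w x y) ->
  exists u, [/\ ultrametric u, dominates e u & OPT_free e w = wcost e w u].
Proof.
move=> w0; apply: (@inf_attained _ _ (fun f => wcost e w (natfun f))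
                     (free_costs e w)).
  move=> s [u [uu ud ->]]; have [vv vd vu] := diam_feasible uu ud.
  pose f : {ffun V * V -> 'I_#|V|.+1} := [ffun p => inord (diam u p.1 p.2)].
  have fE : natfun f = fun x y => (diam u x y)%:R.
    apply/funext => x; apply/funext => y; rewrite /natfun ffunE inordK //= ltnS.
    by apply: diam_le => a b _ _; apply: gdist_le_card.
  by exists f; rewrite fE; [eexists; split; [exact: vv | by [] | by []]
                           | exact: wcost_le].
pose u (x y : V) : R := if x == y then 0 else #|V|%:R.
have u0 x y : 0 <= u x y by rewrite /u; case: ifP => // _; apply: ler0n.
have uC x y : u x y = u y x by rewrite /u eq_sym.
have uU x y z : u x y <= Num.max (u x z) (u z y).
  rewrite le_max /u; have [_|xy] := eqVneq x y; first by rewrite (u0 x z).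
  by have [xz|_] := eqVneq x z; rewrite ?lexx // -xz (negPf xy) lexx orbT.
exists (wcost e w u), u; split=> //.
  split=> //; split=> // x y.
    rewrite /u; have [->//|/eqP xy] := eqVneq x y; split=> // /eqP.
    by rewrite pnatr_eq0 => /eqP V0; have := card0_eq V0 x; rewrite !inE.
  by move=> z; apply: le_trans (uU x y z) _; rewrite ge_max lerDl lerDr !u0.
move=> x y; rewrite /u; have [->|_] := eqVneq x y.
  by rewrite (eqP (_ : gdist e y y == 0%N)) ?gdist_eq0.
by rewrite ler_nat gdist_le_card.
Qed.

Lemma OPT_card_min :
  (exists H : btree V, hierarchy H /\ dominates e (hcardR R H)) ->
  exists H : btree V, [/\ hierarchy H, dominates e (hcardR R H)
                        & OPT_card e w = wcost e w (hcardR R H)].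
Proof.
move=> [H [hH dH]]; apply: (@inf_attained _ _ (fun f => wcost e w (natfun f))
                              (card_costs e w)); last first.
  by exists (wcost e w (hcardR R H)), H.
move=> s [K [hK dK ->]].
pose f : {ffun V * V -> 'I_#|V|.+1} := [ffun p => inord (hcard K p.1 p.2)].
suff fE : natfun f = hcardR R K by exists f; rewrite fE //; exists K.
apply/funext => x; apply/funext => y; rewrite /natfun ffunE inordK //= ltnS.
rewrite /hcard; case: ifP => // _.
exact: leq_trans (leq_pred _) (max_card _).
Qed.

End Minima.

(* Main.v *)
(** For the upper factor let [u] be an optimal ultrametric. The relation
    [u x y < 2] is an equivalence whose classes are cliques. Inside a class of
    size [m], a caterpillar obtained by deleting vertices of minimal weighted
    degree costs at most [(2m - 1)/3] times the total weight, while [u >= 1] on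
    edges. The classes are then joined one at a time along edges of the graph;
    an edge between two classes is split at cost at most
    [n - 1 <= 2 (2n - 1)/3 <= u (2n - 1)/3]. All clusters are connected, so the
    hierarchy dominates the graph distance. On [K_n] all binary hierarchies
    have the same cost, which gives equality. *)
Require Import Defs.
From mathcomp Require Import all_boot all_order all_algebra.
From mathcomp Require Import boolp classical_sets reals.
From mathcomp Require Import zify ring lra.
Set Implicit Arguments.
Unset Strict Implicit.
Unset Printing Implicit Defensive.
Import Order.TTheory GRing.Theory Num.Theory.
Local Open Scope ring_scope.

(** * Graph distance: walks as upper bounds, and adjacency at distance one *)

Lemma gdist_le_size (V : finType) (e : rel V) (x : V) (p : seq V) :
  path e x p -> (gdist e x (last x p) <= size p)%N.
Proof.
(* [find] only inspects lengths below [#|V|]; for longer walks the general bound [gdist <= #|V|]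
   suffices. *)
move=> ep; have [sp|/(leq_trans (gdist_le_card _ _ _))//] := ltnP (size p) #|V|.
rewrite leqNgt; apply/negP => /(before_find 0%N).
rewrite nth_iota // add0n // => /negbT/negP; apply; apply/existsP.
by exists (in_tuple p); rewrite /= ep eqxx.
Qed.

Lemma gdist_le1 (V : finType) (e : rel V) (x y : V) :
  (1 < #|V|)%N -> (gdist e x y <= 1)%N -> x != y -> e x y.
Proof.
move=> V1 d1 xy; have : gdist e x y = 1%N.
  by apply/eqP; rewrite eqn_leq d1 lt0n gdist_eq0.
(* [#|V|] is the default value when no walk is found. As [1 < #|V|], the value 1 comes from an
   actual walk. *)
move=> d; have dV : (gdist e x y < #|V|)%N by rewrite d.
have hs : has (fun k : nat => [exists p : k.-tuple V,
    path e x p && (last x p == y)]) (iota 0 #|V|).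
  by rewrite has_find size_iota.
have := nth_find 0%N hs; rewrite -/(gdist e x y) nth_iota // add0n d.
case/existsP => p; case/tupleP: p => z p; rewrite tuple0 /= andbT.
by case/andP => exz /eqP<-.
Qed.

(** * Clusters of binary trees, the ultrametric [hcard], and connected clusters *)

Section Trees.
Variable V : finType.
Implicit Types (t l r : btree V) (x y z : V) (e : rel V).

Lemma cluster_Leaf x : cluster (Leaf x) = [set x]%SET.
Proof. by apply/setP => y; rewrite !inE. Qed.

Lemma cluster_Node l r : cluster (Node l r) = cluster l :|: cluster r.
Proof. by apply/setP => x; rewrite !inE mem_cat. Qed.

Lemma card_cluster t : uniq (leaves t) -> #|cluster t| = size (leaves t).
Proof. by move=> ut; rewrite cardsE; apply/card_uniqP. Qed.

Lemma cluster_gt0 t : (0 < #|cluster t|)%N.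
Proof.
rewrite card_gt0; apply/set0Pn; elim: t => [x|l [x xl] r _].
  by exists x; rewrite !inE.
by exists x; rewrite cluster_Node inE xl.
Qed.

Lemma uniq_Node l r :
  uniq (leaves (Node l r)) =
  [&& uniq (leaves l), uniq (leaves r) & [disjoint cluster l & cluster r]].
Proof.
rewrite /= cat_uniq; congr (_ && _); rewrite andbC; congr (_ && _).
rewrite disjoint_sym -disjoint_has.
have memE t : cluster t =i leaves t by move=> x; rewrite inE.
by rewrite (eq_disjoint (memE r)) (eq_disjoint_r (memE l)).
Qed.

Lemma hierarchyP t : hierarchy t <-> uniq (leaves t) /\ cluster t = [set: V].
Proof.
split=> [pt|[ut tT]].
  split; first by rewrite (perm_uniq pt) enum_uniq.
  by apply/setP => x; rewrite !inE (perm_mem pt) mem_enum.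
apply: uniq_perm; rewrite ?enum_uniq // => x; rewrite mem_enum.
by have /setP/(_ x) := tT; rewrite !inE.
Qed.

Lemma lca_cluster_sub t x y : lca_cluster t x y \subset cluster t.
Proof.
elim: t => [//|l IHl r IHr] /=.
case: ifP => _.
  by rewrite cluster_Node (fintype.subset_trans IHl) ?finset.subsetUl.
case: ifP => _ //.
by rewrite cluster_Node (fintype.subset_trans IHr) ?finset.subsetUr.
Qed.

Lemma lca_clusterC t x y : lca_cluster t x y = lca_cluster t y x.
Proof.
by elim: t => [//|l IHl r IHr] /=; rewrite IHl IHr ![(x \in _) && _]andbC.
Qed.

(** If all three leaves lie below one child, recurse into it. Otherwise the root separates [z] from
    [x] or from [y], so one term of the maximum is the size of the whole cluster. *)
Lemma lca_cluster_ultra t x y z : uniq (leaves t) ->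
    x \in cluster t -> y \in cluster t -> z \in cluster t ->
  (#|lca_cluster t x y| <= maxn #|lca_cluster t x z| #|lca_cluster t z y|)%N.
Proof.
elim: t => [v|l IHl r IHr]; first by rewrite /= leq_maxl.
rewrite uniq_Node cluster_Node => /and3P[ul ur dlr].
have side v : v \in cluster l :|: cluster r ->
    (v \in cluster l) * (v \in cluster r = false)
    + (v \in cluster l = false) * (v \in cluster r).
  rewrite finset.in_setU; case: (boolP (v \in cluster l)) => [vl _|_ /= vr].
    by left; rewrite (disjointFr dlr vl).
  by right.
have := subset_leq_card (lca_cluster_sub (Node l r) x y).
move=> + /side[] xE /side[] yE /side[] zE; rewrite /= !(xE, yE, zE) /= => le_xy.
all: by [apply: IHl; rewrite ?(xE, yE, zE) | apply: IHr; rewrite ?(xE, yE, zE)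
        | rewrite leq_max le_xy ?orbT].
Qed.

Lemma hcard_ultra t x y z : hierarchy t ->
  (hcard t x y <= maxn (hcard t x z) (hcard t z y))%N.
Proof.
move=> /hierarchyP[ut tT]; rewrite /hcard.
have [//|xy] := eqVneq x y; have [<-|xz] := eqVneq x z.
  by rewrite (negPf xy) leq_maxr.
have [->|zy] := eqVneq z y; first by rewrite leq_maxl.
have := @lca_cluster_ultra t x y z ut.
rewrite tT !inE !leq_max => /(_ isT isT isT)/orP[] h; apply/orP;
  [left | right]; by rewrite -!subn1 leq_sub2r.
Qed.

(** This makes every feasible hierarchy a competitor for [OPT_free], whence the lower factor 1.
    Domination provides positivity off the diagonal. *)
Lemma hcard_ultrametric (R : realType) e t : hierarchy t ->
  dominates e (hcardR R t) -> ultrametric (hcardR R t).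
Proof.
move=> ht dt.
have ultra x y z : hcardR R t x y <= Num.max (hcardR R t x z) (hcardR R t z y).
  by have := hcard_ultra x y z ht; rewrite leq_max le_max !ler_nat.
split=> //; split.
- by move=> x y; apply: ler0n.
- move=> x y; split=> [h0|->]; last by rewrite /hcardR /hcard eqxx.
  apply/eqP; rewrite -(gdist_eq0 e) -leqn0 -(ler_nat R) -[0%N%:R]h0.
  exact: dt.
- by move=> x y; rewrite /hcardR /hcard eq_sym lca_clusterC.
- move=> x y z; apply: le_trans (ultra x y z) _.
  by rewrite ge_max lerDl lerDr !ler0n.
Qed.

(* Equivalently, for symmetric [e]: every cluster of the tree induces a
   connected subgraph. *)
Fixpoint linked e t : bool :=
  match t with
  | Leaf _ => true
  | Node l r => [&& linked e l, linked e r &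
      [exists x in cluster l, exists y in cluster r, e x y]]
  end.

Lemma linked_clique e t : uniq (leaves t) ->
  {in cluster t &, forall x y, x != y -> e x y} -> linked e t.
Proof.
elim: t => [//|l IHl r IHr]; rewrite uniq_Node cluster_Node.
move=> /and3P[ul ur dlr] cl /=; rewrite IHl ?IHr //=.
- have /card_gt0P[x xl] := cluster_gt0 l.
  have /card_gt0P[y yr] := cluster_gt0 r.
  apply/exists_inP; exists x => //; apply/exists_inP; exists y => //.
  apply: cl; rewrite ?finset.in_setU ?xl ?yr ?orbT //.
  by apply/eqP => xy; rewrite xy (disjointFl dlr) in xl.
- by move=> x y xr yr; apply: cl; rewrite finset.in_setU ?xr ?yr orbT.
- by move=> x y xl yl; apply: cl; rewrite ?finset.in_setU ?xl ?yl.
Qed.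

Lemma linked_connect e t : symmetric e -> linked e t ->
  {in cluster t &, forall x y,
    connect [rel a b | [&& a \in cluster t, b \in cluster t & e a b]] x y}.
Proof.
move=> esym; elim: t => [v _ x y|l IHl r IHr].
  by rewrite !inE => /eqP-> /eqP->.
rewrite cluster_Node /= => /and3P[/IHl{}IHl /IHr{}IHr].
case/exists_inP => a al /exists_inP[b br eab].
set E := [rel a b | _]; have csym : connect_sym E.
  by apply: sym_connect_sym => c d; rewrite /= esym andbCA.
have cl : {in cluster l &, forall x y, connect E x y}.
  move=> x y xl yl; apply: connect_sub (IHl _ _ xl yl) => c d /=.
  case/and3P => cc dd ecd.
  by apply: connect1; rewrite /= !finset.in_setU cc dd.
have cr : {in cluster r &, forall x y, connect E x y}.
  move=> x y xr yr; apply: connect_sub (IHr _ _ xr yr) => c d /=.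
  case/and3P => cc dd ecd.
  by apply: connect1; rewrite /= !finset.in_setU cc dd !orbT.
have ab : connect E a b.
  by apply: connect1; rewrite /= !finset.in_setU al br eab orbT.
have lr x y : x \in cluster l -> y \in cluster r -> connect E x y.
  move=> xl yr; apply: connect_trans (cl _ _ xl al) _.
  exact: connect_trans ab (cr _ _ br yr).
move=> x y; rewrite !finset.in_setU => /orP[] xt /orP[] yt.
- exact: cl.
- exact: lr.
- by rewrite csym lr.
- exact: cr.
Qed.

(** A walk inside the cluster shortens to one without repeated vertices, which has at most
    [#|cluster t|] vertices and hence one edge fewer. *)
Lemma linked_gdist e t x y : symmetric e -> linked e t ->
  x \in cluster t -> y \in cluster t -> (gdist e x y <= #|cluster t|.-1)%N.
Proof.
move=> esym lt xt yt.
have /connectP[p0 ep0 ->] := linked_connect esym lt xt yt.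
case/shortenP: ep0 => p ep up _.
apply: leq_trans (gdist_le_size _) _.
  by apply: sub_path ep => a b /= /and3P[].
have : (size (x :: p) <= #|cluster t|)%N.
  rewrite cardE; apply: uniq_leq_size => // z; rewrite mem_enum inE.
  case/orP => [/eqP->//|zp].
  elim: p x {xt up} ep zp => //= b p IH a /andP[/and3P[_ bt _] ep].
  by rewrite inE => /orP[/eqP->//|]; apply: IH ep.
by move=> /= h; rewrite -ltnS (leq_trans h) // leqSpred.
Qed.

(** Descend to the node that separates [x] from [y] and apply [linked_gdist] there: its cluster is
    the one measured by [hcard]. *)
Lemma linked_le_hcard e t x y : symmetric e -> linked e t ->
  x \in cluster t -> y \in cluster t -> (gdist e x y <= hcard t x y)%N.
Proof.
move=> esym; rewrite /hcard; have [->|xy] := eqVneq x y.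
  by rewrite leqn0 gdist_eq0 eqxx.
elim: t => [v _|l IHl r IHr lt].
  by rewrite !inE => /eqP xv /eqP yv; rewrite xv yv eqxx in xy.
have /= /and3P[ll lr _] := lt; move=> xt yt.
case: ifP => [/andP[xl yl]|_]; first exact: IHl.
case: ifP => [/andP[xl yl]|_]; first exact: IHr.
exact: linked_gdist.
Qed.

End Trees.

(** * Costs of trees: recursion at the root, cliques, and joining of classes *)

Section Costs.
Variables (R : realType) (V : finType).
Implicit Types (A B : {set V}) (a f : V -> V -> R) (t l r : btree V).

Definition pairsum f A : R := \sum_(x in A) \sum_(y in A) f x y.

(** Both orientations appear because [pairsum] runs over ordered pairs; the factor 1/2 of [wcost]
    returns in [wcostE]. *)
Definition crosssum f A B : R := \sum_(x in A) \sum_(y in B) (f x y + f y x).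

Definition treecost a t : R :=
  pairsum (fun x y => a x y * hcardR R t x y) (cluster t).

Lemma eq_pairsum f g A : {in A &, f =2 g} -> pairsum f A = pairsum g A.
Proof.
by move=> fg; apply: eq_bigr => x xA; apply: eq_bigr => y yA; apply: fg.
Qed.

Lemma ler_pairsum f g A : {in A &, forall x y, f x y <= g x y} ->
  pairsum f A <= pairsum g A.
Proof.
by move=> fg; apply: ler_sum => x xA; apply: ler_sum => y yA; apply: fg.
Qed.

Lemma ler_crosssum f g A B :
  {in A & B, forall x y, f x y <= g x y /\ f y x <= g y x} ->
  crosssum f A B <= crosssum g A B.
Proof.
move=> fg; apply: ler_sum => x xA; apply: ler_sum => y yB.
by have [fg1 fg2] := fg x y xA yB; apply: lerD.
Qed.

Lemma pairsumZ c f A : pairsum (fun x y => f x y * c) A = pairsum f A * c.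
Proof. by rewrite big_distrl; apply: eq_bigr => x _; rewrite big_distrl. Qed.

Lemma crosssumZ c f A B :
  crosssum (fun x y => f x y * c) A B = crosssum f A B * c.
Proof.
rewrite big_distrl; apply: eq_bigr => x _; rewrite big_distrl.
by apply: eq_bigr => y _ /=; rewrite mulrDl.
Qed.

Lemma pairsum_ge0 f A : (forall x y, 0 <= f x y) -> 0 <= pairsum f A.
Proof. by move=> f0; apply: sumr_ge0 => x _; apply: sumr_ge0. Qed.

Lemma pairsumU f A B : [disjoint A & B] ->
  pairsum f (A :|: B) = pairsum f A + pairsum f B + crosssum f A B.
Proof.
move=> dAB; have sumU F : \sum_(x in A :|: B) F x =
    \sum_(x in A) F x + \sum_(x in B) F x :> R.
  by rewrite -bigU //; apply: eq_bigl => x; rewrite finset.in_setU.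
rewrite /pairsum /crosssum; under eq_bigr do rewrite sumU.
rewrite big_split /= !sumU.
under [X in _ = _ + X]eq_bigr do rewrite big_split /=.
rewrite big_split /= [X in _ = _ + (_ + X)]exchange_big /=.
ring.
Qed.

Lemma pairsum1 f x : pairsum f [set x] = f x x.
Proof. by rewrite /pairsum !big_set1. Qed.

Lemma treecost_Leaf a x : treecost a (Leaf x) = 0.
Proof.
by rewrite /treecost cluster_Leaf pairsum1 /hcardR /hcard eqxx mulr0.
Qed.

Lemma treecost_Node a l r : uniq (leaves (Node l r)) ->
  treecost a (Node l r) = treecost a l + treecost a r
    + crosssum a (cluster l) (cluster r)
      * (#|cluster l|%:R + #|cluster r|%:R - 1).
Proof.
move=> u; have := u; rewrite uniq_Node => /and3P[ul ur dlr].
have cardE : #|cluster (Node l r)| = (#|cluster l| + #|cluster r|)%N.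
  by rewrite !card_cluster // size_cat.
rewrite /treecost {1}cluster_Node pairsumU //; congr (_ + _ + _).
- apply: eq_pairsum => x y xl yl; rewrite /hcardR /hcard /=.
  by rewrite xl yl.
- apply: eq_pairsum => x y xl yl; rewrite /hcardR /hcard /=.
  by rewrite (disjointFl dlr xl) xl yl.
rewrite -crosssumZ; apply: eq_bigr => x xl; apply: eq_bigr => y yr.
have xr := disjointFr dlr xl; have yl := disjointFl dlr yr.
have /negPf xy : x != y by apply/eqP => xy; rewrite xy yl in xl.
rewrite /hcardR /hcard (eq_sym y x) xy /= xl yl yr xr /= cardE.
have := cluster_gt0 l; case: #|cluster l| => // k _.
by rewrite addSn /= -natr1 natrD addrAC addrK.
Qed.

(** The function [F k = k (k - 1) (2 k - 1) / 3] satisfies [F (p + q) = F p + F q + 2 p q (p + q -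
    1)], which is the recursion of [treecost_Node] here, whatever the shape of the tree. *)
Lemma treecost_complete t : uniq (leaves t) ->
  treecost (fun x y => (x != y)%:R) t =
    #|cluster t|%:R * (#|cluster t|%:R - 1) * (2 * #|cluster t|%:R - 1) / 3.
Proof.
elim: t => [x _|l IHl r IHr u].
  by rewrite treecost_Leaf card_cluster //=; ring.
have := u; rewrite uniq_Node => /and3P[ul ur dlr].
rewrite treecost_Node // IHl // IHr //.
have -> : #|cluster (Node l r)| = (#|cluster l| + #|cluster r|)%N.
  by rewrite !card_cluster // size_cat.
have -> : crosssum (fun x y => (x != y)%:R) (cluster l) (cluster r)
          = 2 * #|cluster l|%:R * #|cluster r|%:R.
  rewrite /crosssum (eq_bigr (fun=> 2 * #|cluster r|%:R)).
    by rewrite sumr_const -[LHS]mulr_natr; ring.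
  move=> x xl; rewrite (eq_bigr (fun=> 2)).
    by rewrite sumr_const -[LHS]mulr_natr.
  move=> y yr; rewrite eq_sym.
  have /negPf -> // : y != x.
  by apply/eqP => xy; rewrite -xy (disjointFl dlr yr) in xl.
by rewrite natrD; field.
Qed.

(* Split off a vertex of minimal weighted degree, which is at most the average
   [2 * pairsum a A / #|A|], and recurse. *)
Lemma mindeg_tree a A : (forall x y, 0 <= a x y) -> A != finset.set0 ->
  exists t, [/\ uniq (leaves t), cluster t = A
    & treecost a t <= pairsum a A * ((2 * #|A|%:R - 1) / 3)].
Proof.
move=> a0; move cA : #|A| => m; elim: m A cA => [A /eqP|m IH A cA _].
  by rewrite cards_eq0 => ->.
pose deg v := \sum_(y in A :\ v) (a v y + a y v).
(* The degrees count each ordered pair of distinct vertices twice; the diagonal of [pairsum] only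
   enlarges the right side. *)
have deg_sum : \sum_(v in A) deg v <= 2 * pairsum a A.
  have -> : 2 * pairsum a A = \sum_(v in A) \sum_(y in A) (a v y + a y v).
    under eq_bigr do rewrite big_split /=.
    by rewrite big_split /= [X in _ + X]exchange_big /= -/(pairsum a A); ring.
  apply: ler_sum => v vA; rewrite [leRHS](big_setD1 v) //= lerDr.
  by rewrite addr_ge0.
have [v0 v0A] : exists v, v \in A by apply/card_gt0P; rewrite cA.
case: (@arg_minP _ _ _ v0 (fun v => v \in A) deg v0A) => v vA vmin {v0 v0A}.
have degv : deg v * m.+1%:R <= 2 * pairsum a A.
  apply: le_trans deg_sum; rewrite mulr_natr -cA -sumr_const.
  exact: ler_sum.
have cAv : #|A :\ v| = m by have := cardsD1 v A; rewrite vA cA => -[].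
have vAv : [disjoint [set v]%SET & A :\ v] by rewrite disjoints1 !inE eqxx.
have defA : A = ([set v] :|: A :\ v)%SET by rewrite finset.setD1K.
have sumA : pairsum a A = a v v + pairsum a (A :\ v) + deg v.
  by rewrite {1}defA pairsumU // pairsum1 /crosssum big_set1.
case: m IH cA degv cAv => [_|m IH] cA degv cAv.
  exists (Leaf v); rewrite treecost_Leaf; split=> //.
    by rewrite defA (cards0_eq cAv) finset.setU0 cluster_Leaf.
  by rewrite mulr_ge0 ?pairsum_ge0 //; lra.
have [|t [ut tA ct]] := IH _ cAv; first by rewrite -card_gt0 cAv.
have uN : uniq (leaves (Node (Leaf v) t)).
  by rewrite uniq_Node cluster_Leaf tA ut.
exists (Node (Leaf v) t); split=> //.
  by rewrite cluster_Node cluster_Leaf tA.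
rewrite treecost_Node // treecost_Leaf cluster_Leaf tA /crosssum big_set1.
rewrite -/(deg v) cards1 cAv sumA.
(* In the notation introduced below, the induction hypothesis reduces the goal to
   [d * M <= 2 * W + (2 * M + 3) * b], while minimality of the degree gives
   [d * M <= 2 * W + 2 * b]. *)
have : 0 <= a v v * m%:R by rewrite mulr_ge0.
move: degv ct (a0 v v); rewrite sumA -(natr1 m.+1) -(natr1 m).
move: (pairsum _ _) (deg v) (treecost a t) (a v v) (m%:R : R).
by move=> W d c b M; lra.
Qed.

(** Related pairs are charged the rate of [mindeg_tree] with the class size relaxed to [#|V|]; all
    other pairs are charged the largest possible height [#|V| - 1]. *)
Lemma partition_tree (e r : rel V) a : symmetric e ->
    (forall x y, connect e x y) -> (0 < #|V|)%N -> equivalence_rel r ->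
    (forall x y, r x y -> x != y -> e x y) -> (forall x y, 0 <= a x y) ->
  exists t, [/\ hierarchy t, linked e t & treecost a t <=
    pairsum (fun x y => a x y * if r x y then (2 * #|V|%:R - 1) / 3
                                else #|V|%:R - 1) [set: V]].
Proof.
move=> esym econn V0 req rcl a0.
pose b x y := a x y * if r x y then (2 * #|V|%:R - 1) / 3 else #|V|%:R - 1.
have rxx x : r x x by have [] := req x x x.
have rC x y : r x y -> r y x by move=> rxy; have [_ /(_ rxy) <-] := req x y x.
have cardV A : (#|A|%:R : R) <= #|V|%:R by rewrite ler_nat max_card.
have class_tree x : exists t, [/\ uniq (leaves t),
    cluster t = [set y | r x y]%SET, linked e t
    & treecost a t <= pairsum b (cluster t)].
  have [|t [ut tE ct]] := @mindeg_tree a [set y | r x y]%SET a0.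
    by apply/finset.set0Pn; exists x; rewrite inE.
  have rt : {in cluster t &, forall y z, r y z}.
    move=> y z; rewrite tE !inE => xy xz.
    by have [_ /(_ xy) <-] := req x y z.
  exists t; split=> //.
    by apply: linked_clique => // y z yt zt; apply: rcl; apply: rt.
  apply: le_trans ct _; rewrite -pairsumZ tE; apply: ler_pairsum => y z.
  rewrite -tE => yt zt; rewrite /b rt // ler_wpM2l //.
  by rewrite ler_wpM2r ?invr_ge0 // lerB // ler_wpM2l.
(* Induction on the number of uncovered vertices. The invariant: the tree is linked, its cluster is
   a union of classes, and its cost is within the charge. *)
have grow k : forall t, uniq (leaves t) -> linked e t ->
    (forall x y, r x y -> x \in cluster t -> y \in cluster t) ->
    treecost a t <= pairsum b (cluster t) -> (#|~: cluster t| <= k)%N ->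
  exists t', [/\ hierarchy t', linked e t'
    & treecost a t' <= pairsum b [set: V]].
  elim: k => [|k IH] t ut lt rt ct kt.
    have tT : cluster t = [set: V].
      move: kt; rewrite leqn0 cards_eq0 => /eqP/(congr1 (@finset.setC V)).
      by rewrite finset.setCK finset.setC0.
    by exists t; split=> //; [apply/hierarchyP | rewrite -tT].
  have [tT|] := eqVneq (cluster t) [set: V].
    by exists t; split=> //; [apply/hierarchyP | rewrite -tT].
  rewrite -properT => /properP[_ [z _ zt]].
  (* Without an edge leaving it, the cluster would be closed under [e], and connectivity would put
     [z] into it. *)
  have /exists_inP[x xt /exists_inP[y yt exy]] :
      [exists x in cluster t, [exists y in ~: cluster t, e x y]].
    have /card_gt0P[x0 x0t] := cluster_gt0 t.
    apply: contraT => /exists_inPn noedge.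
    have tcl : closed e (mem (cluster t)).
      apply: (intro_closed (sym_connect_sym esym)) => x y exy xt.
      apply: contraT => yt; case/negP: (noedge x xt); apply/exists_inP.
      by exists y; rewrite ?finset.in_setC.
    by rewrite -(closed_connect tcl (econn x0 z)) x0t in zt.
  rewrite finset.in_setC in yt.
  have [s [us sE ls cs]] := class_tree y.
  (* The cluster is a union of classes and misses [y], so no cross pair is related, and each is
     charged [#|V| - 1]. *)
  have rts u v : u \in cluster t -> v \in cluster s -> ~~ r u v.
    move=> ut' vs; apply: contra yt => ruv; move: vs; rewrite sE inE => /rC rvy.
    by exact: rt _ _ rvy (rt _ _ ruv ut').
  have dts : [disjoint cluster t & cluster s].
    apply/pred0P => u /=; apply/negbTE/negP => /andP[/rts h /h].
    by rewrite rxx.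
  have uN : uniq (leaves (Node t s)) by rewrite uniq_Node ut us dts.
  have ys : y \in cluster s by rewrite sE inE.
  have cardN : #|cluster (Node t s)| = (#|cluster t| + #|cluster s|)%N.
    by rewrite !card_cluster // size_cat.
  apply: (IH _ uN).
  - rewrite /= lt ls /=; apply/exists_inP; exists x => //.
    by apply/exists_inP; exists y.
  - move=> u v ruv; rewrite cluster_Node !finset.in_setU.
    case/orP => [/(rt _ _ ruv)->//|]; rewrite sE !inE => ryu.
    by have [_ /(_ ryu) ->] := req y u v; rewrite ruv orbT.
  - rewrite treecost_Node // cluster_Node pairsumU // lerD ?(lerD ct cs) //.
    rewrite -crosssumZ; apply: ler_crosssum => u v ut' vs; rewrite /b.
    have ruv := rts u v ut' vs; have rvu : ~~ r v u by apply: contra ruv => /rC.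
    rewrite (negPf ruv) (negPf rvu).
    have : #|cluster t|%:R + #|cluster s|%:R <= #|V|%:R :> R.
      by rewrite -natrD -cardN.
    by move=> h; rewrite !ler_wpM2l ?lerB.
  - have := cardsC (cluster t); have := cardsC (cluster (Node t s)).
    have := cluster_gt0 s; rewrite cardN; lia.
have /card_gt0P[x0 _] := V0.
have [t [ut tE lt ct]] := class_tree x0.
apply: (grow _ t ut lt _ ct (leqnn _)) => x y rxy.
by rewrite tE !inE => r0; have [_ /(_ r0) ->] := req x0 x y.
Qed.

End Costs.

(** * From an ultrametric to a hierarchy, and positivity of the free optimum *)

Section Optima.
Variables (R : realType) (V : finType) (e : rel V) (w : V -> V -> R).
Implicit Types (u : V -> V -> R) (t : btree V).
Hypothesis w_gt0 : forall x y, e x y -> 0 < w x y.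

(** [w] is arbitrary off the edges; extending it by zero lets sums run over all pairs with
    nonnegative weights. *)
Let a x y : R := if e x y then w x y else 0.

Let a_ge0 x y : 0 <= a x y.
Proof. by rewrite /a; case: ifP => // /w_gt0/ltW. Qed.

Lemma wcostE u :
  wcost e w u = pairsum (fun x y => a x y * u x y) [set: V] / 2.
Proof.
rewrite /wcost /pairsum; congr (_ / 2); apply: eq_big => [x|x _].
  by rewrite finset.in_setT.
rewrite big_mkcond /=; apply: eq_big => [y|y _].
  by rewrite finset.in_setT.
by rewrite /a; case: ifP => //; rewrite mul0r.
Qed.

Lemma OPT_free_le u : ultrametric u -> dominates e u ->
  OPT_free e w <= wcost e w u.
Proof.
move=> uu du; apply: ge_inf; last by exists u.
exists 0 => _ [v [[[v0 _ _ _] _] _ ->]]; rewrite wcostE divr_ge0 //.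
by apply: pairsum_ge0 => x y; rewrite mulr_ge0.
Qed.

Lemma OPT_card_le t : hierarchy t -> dominates e (hcardR R t) ->
  OPT_card e w <= wcost e w (hcardR R t).
Proof.
move=> ht dt; apply: ge_inf; last by exists t.
exists 0 => _ [s [_ _ ->]]; rewrite wcostE divr_ge0 //.
by apply: pairsum_ge0 => x y; rewrite mulr_ge0 ?ler0n.
Qed.

Lemma dominates_ge1 u x y : irreflexive e -> dominates e u -> e x y ->
  1 <= u x y.
Proof.
move=> eirr du exy; apply: le_trans (du x y).
rewrite ler1n lt0n gdist_eq0; apply: contraTneq exy => ->.
by rewrite eirr.
Qed.

(** Already one edge contributes a positive amount. This keeps the ratio from being a division by
    zero. *)
Lemma OPT_free_gt0 x y : irreflexive e -> e x y -> 0 < OPT_free e w.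
Proof.
move=> eirr exy; have [u [[[u0 _ _ _] _] du ->]] := OPT_free_min w_gt0.
have au0 v z : 0 <= a v z * u v z by rewrite mulr_ge0.
rewrite wcostE divr_gt0 // /pairsum (bigD1 x) ?finset.in_setT //=.
rewrite (bigD1 y) ?finset.in_setT //= -addrA ltr_wpDr //.
  by rewrite addr_ge0 //; apply: sumr_ge0 => *; rewrite ?sumr_ge0.
have := dominates_ge1 eirr du exy; rewrite /a exy => u1.
by rewrite mulr_gt0 ?w_gt0 // (lt_le_trans ltr01).
Qed.

(** Besides the upper factor, this yields the feasible hierarchy that [OPT_card_min] asks for. *)
Lemma ultrametric_hierarchy u : (1 < #|V|)%N -> symmetric e ->
    irreflexive e -> (forall x y, connect e x y) ->
    ultrametric u -> dominates e u ->
  exists t, [/\ hierarchy t, dominates e (hcardR R t)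
    & wcost e w (hcardR R t) <= (2 * #|V|%:R - 1) / 3 * wcost e w u].
Proof.
move=> V1 esym eirr econn [[u0 us uC _] uU] du.
(* Graph distances are integers, so a value below 2 forces distance at most 1: classes are
   cliques. *)
pose r : rel V := fun x y => u x y < 2.
have rtr x y z : r x y -> r y z -> r x z.
  move=> xy yz; apply: le_lt_trans (uU x z y) _.
  by rewrite gt_max; apply/andP; split.
have rC x y : r x y = r y x by rewrite /r uC.
have req : equivalence_rel r.
  move=> x y z; split; first by rewrite /r (us z z).2.
  move=> xy; apply/idP/idP; last exact: rtr.
  by apply: rtr; rewrite rC.
have rcl x y : r x y -> x != y -> e x y.
  move=> xy; apply: gdist_le1 => //.
  by rewrite -ltnS -(ltr_nat R) (le_lt_trans (du x y)).
have [t [ht lt ct]] := partition_tree esym econn (ltnW V1) req rcl a_ge0.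
have [ut tT] := (hierarchyP t).1 ht.
exists t; split=> //.
  by move=> x y; rewrite ler_nat linked_le_hcard // tT inE.
rewrite !wcostE mulrA ler_wpM2r ?invr_ge0 // mulrC -pairsumZ -tT.
apply: le_trans ct _; rewrite tT; apply: ler_pairsum => x y _ _.
rewrite -mulrA /a; case: (boolP (e x y)) => [exy|_]; last by rewrite !mul0r.
rewrite ler_wpM2l ?(ltW (w_gt0 exy)) //.
have V2 : 2 <= #|V|%:R :> R by rewrite ler_nat.
have u1 := dominates_ge1 eirr du exy.
case: ifPn => [_|]; first by rewrite ler_peMl //; lra.
by rewrite /r -leNgt => u2; nra.
Qed.

End Optima.

(** * The two bounds on the ratio, and equality on complete graphs *)

Lemma OPT_ratio_bounds (R : realType) (V : finType) (e : rel V)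
    (w : V -> V -> R) : (1 < #|V|)%N ->
    symmetric e -> irreflexive e -> (forall x y, connect e x y) ->
    (forall x y, e x y -> 0 < w x y) ->
  0 < OPT_free e w /\
  1 <= OPT_card e w / OPT_free e w <= (2 * #|V|%:R - 1) / 3.
Proof.
move=> V1 esym eirr econn w0.
(* The first step of a walk between two distinct vertices is an edge. *)
have [x [y exy]] : exists x y, e x y.
  have [x [y [_ _ xy]]] := card_gt1P V1.
  have /connectP[[|z p] /= ep yE] := econn x y; first by rewrite yE eqxx in xy.
  by exists x, z; case/andP: ep.
have free_gt0 := OPT_free_gt0 w0 eirr exy; split=> //.
have [u [uu du freeE]] := OPT_free_min w0.
have [t [ht dt ct]] := ultrametric_hierarchy w0 V1 esym eirr econn uu du.
apply/andP; split.
  have [|s [hs ds cardE]] := @OPT_card_min R V e w; first by exists t.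
  rewrite ler_pdivlMr // mul1r cardE OPT_free_le //.
  exact: hcard_ultrametric ds.
rewrite ler_pdivrMr // freeE; apply: le_trans ct.
exact: OPT_card_le.
Qed.

(** With [n = #|V|], the discrete metric costs [n (n - 1) / 2], and by [treecost_complete] every
    hierarchy costs [n (n - 1) (2 n - 1) / 6]. *)
Lemma OPT_ratio_complete (R : realType) (V : finType) : (1 < #|V|)%N ->
  OPT_card (@complete V) (fun _ _ => 1 : R)
    / OPT_free (@complete V) (fun _ _ => 1 : R) = (2 * #|V|%:R - 1) / 3.
Proof.
move=> V1; set e := @complete V; set w := fun _ _ => 1.
have w0 (x y : V) : e x y -> 0 < w x y by rewrite ltr01.
have esym : symmetric e by move=> x y; rewrite /e /complete eq_sym.
have eirr : irreflexive e by move=> x; rewrite /e /complete eqxx.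
have econn x y : connect e x y.
  by have [->//|xy] := eqVneq x y; apply: connect1.
have [free_gt0 /andP[_ ratio_le]] := OPT_ratio_bounds V1 esym eirr econn w0.
(* Only the lower bound on the ratio remains, so bounding [OPT_free] from above by the cost of one
   ultrametric is enough. *)
apply/eqP; rewrite eq_le ratio_le ler_pdivlMr //=.
have wE v : wcost e w v = pairsum (fun x y => (x != y)%:R * v x y) [set: V] / 2.
  rewrite wcostE; congr (_ / 2); apply: eq_pairsum => x y _ _.
  by rewrite /e /complete; case: (x != y).
pose u (x y : V) : R := (x != y)%:R.
have uU x y z : u x y <= Num.max (u x z) (u z y).
  rewrite le_max !ler_nat; have [->|] := eqVneq x z; last by case: (x != y).
  by rewrite leqnn orbT.
have uu : ultrametric u.
  split=> //; split=> [x y|x y|x y|x y z]; rewrite ?ler0n //.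
  - split=> [/eqP|->]; last by rewrite /u eqxx.
    by rewrite /u pnatr_eq0 eqb0 negbK => /eqP.
  - by rewrite /u eq_sym.
  - by apply: le_trans (uU x y z) _; rewrite ge_max lerDl lerDr !ler0n.
have du : dominates e u.
  move=> x y; rewrite ler_nat; have [->|xy] := eqVneq x y.
    by rewrite leqn0 gdist_eq0.
  by apply: (@gdist_le_size _ e x [:: y]); rewrite /= andbT.
have cu : wcost e w u = #|V|%:R * (#|V|%:R - 1) / 2.
  rewrite wE /pairsum; congr (_ / 2).
  have -> : \sum_(x in [set: V]) \sum_(y in [set: V]) (x != y)%:R * u x y
    = \sum_(x : V) (#|V|%:R - 1).
    apply: eq_big => [x|x _]; first by rewrite finset.in_setT.
    rewrite (bigD1 x) ?finset.in_setT //= /u eqxx mul0r add0r.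
    rewrite (eq_bigr (fun=> 1)) => [|y /andP[_ yx]]; last first.
      by rewrite eq_sym yx mulr1.
    rewrite (eq_bigl (fun y => y \in predC1 x)) => [|y]; last first.
      by rewrite finset.in_setT inE.
    by rewrite sumr_const cardC1 -subn1 natrB // (ltnW V1).
  by rewrite sumr_const mulr_natl.
apply: le_trans (ler_wpM2l _ (OPT_free_le w0 uu du)) _.
  by rewrite divr_ge0 // subr_ge0 -natrM ler1n muln_gt0 (ltnW V1).
have [|t [ht dt ->]] := @OPT_card_min R V e w.
  have [t [ht dt _]] := ultrametric_hierarchy w0 V1 esym eirr econn uu du.
  by exists t.
rewrite cu wE; have [ut tT] := (hierarchyP t).1 ht.
have := treecost_complete R ut; rewrite /treecost tT cardsT => ->.
by rewrite le_eqVlt; apply/orP; left; apply/eqP; field.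
Qed.

Theorem theorem7 (R : realType) :
  (forall (n : nat) (V : finType) (e : rel V) (w : V -> V -> R),
     (2 <= n)%N -> #|V| = n ->
     symmetric e -> irreflexive e -> (forall x y, connect e x y) ->
     (forall x y, e x y -> w x y = w y x) ->
     (forall x y, e x y -> 0 < w x y) ->
     1 <= OPT_card e w / OPT_free e w <= (2 * n%:R - 1) / 3)
  /\
  (forall n : nat, (2 <= n)%N ->
     OPT_card (@complete 'I_n) (fun _ _ => 1 : R)
       / OPT_free (@complete 'I_n) (fun _ _ => 1 : R) = (2 * n%:R - 1) / 3).
Proof.
split=> [n V e w n2 cV esym eirr econn _ w0|n n2].
  rewrite -cV in n2 *.
  by have [] := OPT_ratio_bounds n2 esym eirr econn w0.
by rewrite OPT_ratio_complete card_ord.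
Qed.
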